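(* Let $X$ be a real Banach space, let $f:X\to\,]-\infty,+\infty]$ be proper and lower semicontinuous, let $C\subset X$ be convex and let $\bar{x}\in C$. Then the following are equivalent: (a) $f'(y;\bar{x}-y)\le 0$ for every $y\in C\cap\operatorname{dom} f$; (b) $f(y+t(\bar{x}-y))\le f(y)$ for every $y\in C$ and every $t\in[0,1]$.
   Context: For a function $f:X\to\,]-\infty,+\infty]$, put $\operatorname{dom} f:=\{x\in X : f(x)<\infty\}$; $f$ is proper if $\operatorname{dom} f\neq\emptyset$. The (radial or lower Dini) subderivative of $f$ at a point $x\in\operatorname{dom} f$ in the direction $d\in X$ is $$f'(x;d):=\liminf_{t\searrow 0}\frac{f(x+td)-f(x)}{t}\in[-\infty,+\infty].$$ Inequalities between values of $f$ are understood in $]-\infty,+\infty]$, with $+\infty\le+\infty$. *)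

(* Defs.v *)
From mathcomp Require Import all_boot all_order all_algebra.
From mathcomp Require Import all_classical all_reals all_analysis.

Set Implicit Arguments.
Unset Strict Implicit.
Unset Printing Implicit Defensive.

Import Order.TTheory GRing.Theory Num.Theory.
Import numFieldNormedType.Exports.

Local Open Scope classical_set_scope.
Local Open Scope ring_scope.
Local Open Scope ereal_scope.

Section subderivative.
Context {R : realType} {X : normedModType R}.
Implicit Types (f : X -> \bar R) (x d : X).

Definition edom f : set X := [set x | f x < +oo].

(* [f] takes values in ]-oo, +oo] and is not identically +oo. *)
Definition eproper f : Prop := (forall x, -oo < f x) /\ edom f !=set0.

(* The lower Dini (radial) subderivative f'(x; d), the lower limit being taken
   in \bar R as t tends to 0 with t > 0. It is meaningful for [f] with values
   in ]-oo, +oo] and [x] in [edom f]: then [f x] is a real number and the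
   difference quotient never involves +oo - +oo. *)
Definition subderivative f x d : \bar R :=
  limf_einf (fun t : R => (f (x + t *: d)%R - f x) * (t^-1)%:E) 0^'+.

End subderivative.

(* Main.v *)
Require Import Defs.
From mathcomp Require Import all_boot all_order all_algebra.
From mathcomp Require Import all_classical all_reals all_analysis.
From mathcomp Require Import ring lra.

Import Order.TTheory GRing.Theory Num.Theory.
Import numFieldNormedType.Exports.

Local Open Scope classical_set_scope.
Local Open Scope ring_scope.
Local Open Scope ereal_scope.

(** (a) => (b): restrict [f] to the segment, [g s = f (y + s (xbar - y))], and
    fix [eps > 0]. The set of [s] in [0, t] with [g s <= g 0 + eps s] contains
    its supremum because [g] is lower semicontinuous; at a point [s < t] of this
    set the subderivative of [g] is nonpositive, so that it contains a larger
    point of [0, t]. Hence the supremum is [t], and [eps] tends to [0]. *)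

Lemma lower_semicontinuous_comp (T U : topologicalType) (R : realType)
    (f : U -> \bar R) (h : T -> U) :
  lower_semicontinuous f -> continuous h -> lower_semicontinuous (f \o h).
Proof.
move=> lscf ch x a /lscf[V Vx Va].
exists (h @^-1` V); first exact: ch.
by move=> y /Va.
Qed.

Lemma lower_semicontinuous_le_line (R : realType) (g : R -> \bar R)
    (v e b : R) :
  lower_semicontinuous g -> (0 <= e)%R -> (0 <= b)%R -> g 0%R <= v%:E ->
  (forall s, (0 <= s < b)%R -> g s <= (v + e * s)%:E ->
    exists2 u, (s < u <= b)%R & g u <= (v + e * u)%:E) ->
  g b <= (v + e * b)%:E.
Proof.
move=> lscg e0 b0 g0 step.
pose T := [set s | (0 <= s <= b)%R /\ g s <= (v + e * s)%:E].
have T0 : T 0%R by rewrite /T/= lexx b0 mulr0 addr0.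
have ubT : has_ubound T by exists b => s [/andP[]].
have Tle : ubound T (sup T) by exact: ub_le_sup.
have supb : (sup T <= b)%R by apply: ge_sup; [exists 0%R | move=> s [/andP[]]].
have gsup : g (sup T) <= (v + e * sup T)%:E.
  (* Otherwise [g] exceeds the bound at [sup T] on a whole neighbourhood [V]. As [sup T] lies in the
     closure of [T], some [s] in [T] lies in [V]; but its own bound is no larger, since [s <= sup T]
     and [e >= 0]. *)
  rewrite leNgt; apply/negP => /lscg[V /(closure_sup _ ubT) + Vgt].
  case; first by exists 0%R.
  move=> s [Ts /Vgt]; have [_ gs] := Ts.
  rewrite ltNge => /negP; apply; apply: (le_trans gs).
  by rewrite lee_fin lerD2l ler_wpM2l// Tle.
have sup0 : (0 <= sup T)%R by exact: Tle.
have [supltb|] := ltP (sup T) b; last first.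
  by move=> bsup; have /eqP -> : b == sup T by rewrite eq_le bsup supb.
have [|u /andP[supu ub] gu] := step _ _ gsup; first by rewrite sup0.
have Tu : T u by split => //; rewrite ub (le_trans sup0)// ltW.
by have := Tle _ Tu; rewrite leNgt supu.
Qed.

Section subderivative_nonpositive.
Context {R : realType} {X : normedModType R}.
Implicit Types (f : X -> \bar R) (x d : X).

(** If every quotient over []0, c]] exceeded [e], the infimum over this right neighbourhood of 0,
    and hence the lower limit, would be at least [e > 0]. *)
Lemma subderivative_le0_step f x d (e c : R) :
  f x \is a fin_num -> subderivative f x d <= 0 -> (0 < e)%R -> (0 < c)%R ->
  exists2 r, (0 < r <= c)%R & f (x + r *: d)%R <= f x + (e * r)%:E.
Proof.
move=> fx df e0 c0; apply: contrapT => noR.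
move: df; rewrite leNgt => /negP; apply.
rewrite /subderivative limf_einfE.
apply: (@lt_le_trans _ _ e%:E); first by rewrite lte_fin.
apply: le_ereal_sup_tmp.
exists (ereal_inf [set (f (x + r *: d)%R - f x) * r^-1%:E
    | r in [set r | (0 < r <= c)%R]]).
  exists [set r | (0 < r <= c)%R] => //.
  near=> r; apply/andP; split; near: r; first exact: nbhs_right_gt.
  exact: nbhs_right_ltW.
apply: le_ereal_inf_tmp => _ [r rc <-]; have /andP[r0 _] := rc.
rewrite lee_pdivlMr// leeBrDr// leNgt; apply/negP => fr; apply: noR.
by exists r => //; rewrite addeC EFinM ltW.
Unshelve. all: by end_near. Qed.

(** Every right neighbourhood of 0 contains some [t > 0] with a nonpositive quotient, so each
    infimum in the lower limit is at most 0. *)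
Lemma subderivative_le0 f x d : f x \is a fin_num ->
  (\forall t \near 0^'+, f (x + t *: d)%R <= f x) -> subderivative f x d <= 0.
Proof.
move=> fx decr; rewrite /subderivative limf_einfE.
apply: ge_ereal_sup => _ [V V0 <-].
have V0' : \forall t \near (0%R : R)^'+, V t by [].
apply: ge_ereal_inf.
have : \forall t \near (0%R : R)^'+,
    [/\ V t, (0 < t)%R & f (x + t *: d)%R <= f x].
  near=> t; split; near: t => //; exact: nbhs_right_gt.
move=> /filter_ex[t [Vt t0 ft]].
exists ((f (x + t *: d)%R - f x) * t^-1%:E); first by exists t.
by rewrite lee_pdivrMr// mul0e leeBlDr// add0e.
Unshelve. all: by end_near. Qed.

End subderivative_nonpositive.

Lemma convex_set_segment (R : realType) (X : lmodType R) (C : set X) (x y : X)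
    (s : R) :
  convex_set (C : set (convex_lmodType X)) -> C x -> C y -> (0 <= s <= 1)%R ->
  C (y + s *: (x - y))%R.
Proof.
move=> cC Cx Cy /andP[s0 s1].
have -> : (y + s *: (x - y) = s *: x + (1 - s) *: y)%R.
  by rewrite scalerBl scale1r scalerBr addrCA.
by have := cC x y (Itv01 s0 s1); rewrite !inE => /(_ Cx Cy).
Qed.

Theorem proposition1p1 (R : realType) (X : completeNormedModType R)
    (f : X -> \bar R) (C : set X) (xbar : X) :
  eproper f -> lower_semicontinuous f ->
  convex_set (C : set (convex_lmodType X)) -> C xbar ->
  (forall y, (C `&` edom f) y -> subderivative f y (xbar - y)%R <= 0)
  <->
  (forall (y : X) (t : R), C y -> (0 <= t <= 1)%R ->
     f (y + t *: (xbar - y))%R <= f y).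
Proof.
move=> [fNy _] lscf convC Cxbar.
have ffin x : f x < +oo -> f x \is a fin_num.
  by move=> fx; rewrite fin_real// fNy.
split=> [sub y t Cy /andP[t0 t1]|decr y [Cy /ffin fy]]; last first.
  (* (b) => (a): every small [t > 0] lies in [[0, 1]]. *)
  apply: subderivative_le0 => //.
  near=> t; apply: decr => //; apply/andP; split; near: t.
    exact: nbhs_right_ge.
  exact: nbhs_right_ltW.
have [fyoo|] := ltP (f y) +oo; last by rewrite leye_eq => /eqP ->; rewrite leey.
have fyE := fineK (ffin _ fyoo).
apply/lee_addgt0Pr => e e0.
pose g s := f (y + s *: (xbar - y))%R.
(* This is enough because [t <= 1] gives [e * t <= e]. *)
suff : g t <= (fine (f y) + e * t)%:E.
  move=> /le_trans; apply; rewrite EFinD fyE leeD2l// lee_fin.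
  by rewrite ler_piMr// ltW.
apply: lower_semicontinuous_le_line => //.
- apply: (lower_semicontinuous_comp _ _ _ f) => // s.
  by apply: cvgD; [exact: cvg_cst | exact: cvgZr_tmp].
- exact: ltW.
- by rewrite /g scale0r addr0 fyE.
move=> s /andP[s0 st] gs.
pose z := (y + s *: (xbar - y))%R.
(* The bound on [g s] puts [z] in the domain of [f], so that (a) applies there. *)
have fz : f z < +oo by rewrite (le_lt_trans gs)// ltry.
have s1 : (s < 1)%R by exact: lt_le_trans st t1.
have zE : (xbar - z = (1 - s) *: (xbar - y))%R.
  by rewrite /z opprD addrA scalerBl scale1r.
have Cz : C z by apply: convex_set_segment => //; rewrite s0 ltW.
have /subderivative_le0_step := sub z (conj Cz fz).
(* A step [r] along [xbar - z] advances the parameter on the segment by [r * (1 - s)]. The slope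
   [e * (1 - s)] thus amounts to slope [e] in that parameter, and [r <= t - s] keeps it at most [t],
   since [1 - s <= 1]. *)
move=> /(_ (e * (1 - s))%R (t - s)%R (ffin _ fz)).
case; [by rewrite mulr_gt0// subr_gt0 | by rewrite subr_gt0|].
move=> r /andP[r0 rts]; rewrite zE => fr.
exists (s + r * (1 - s))%R.
  rewrite ltrDl mulr_gt0// ?subr_gt0//=.
  nra.
have -> : g (s + r * (1 - s))%R = f (z + r *: ((1 - s) *: (xbar - y)))%R.
  by rewrite /g /z scalerA scalerDl addrA.
apply: (le_trans fr).
have -> : (fine (f y) + e * (s + r * (1 - s)) =
    (fine (f y) + e * s) + e * (1 - s) * r)%R by ring.
by rewrite [leRHS]EFinD leeD2r.
Unshelve. all: by end_near. Qed.
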